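(* Let $G$ be an edge-signed graph with $\lambda_1(G)>-2$, and let $v\in V(G)$. Then $\lambda_1(G)>\lambda_1(\hat{A}(G,v))$. Furthermore, $\lambda_1(\hat{A}(G,v))>-2$ if and only if the underlying graph of $G$ is the line graph of a tree $T$ and $v$ corresponds to an end-edge of $T$. Otherwise, $\lambda_1(\hat{A}(G,v))\leqslant -2$.
   Context: All graphs are finite. An edge-signed graph $G$ is a triple $(V,E^+,E^-)$ of a vertex set $V=V(G)$ and two disjoint sets $E^+,E^-$ of $2$-subsets of $V$ (the $(+)$-edges and $(-)$-edges). Its underlying graph is the unsigned graph $(V,E^+\cup E^-)$. Its adjacency matrix $A(G)$ has entry $1$, $-1$, $0$ at $(u,v)$ according as $\{u,v\}\in E^+$, $\{u,v\}\in E^-$, or neither. $\lambda_1$ of a real symmetric matrix is its smallest eigenvalue, and $\lambda_1(G)=\lambda_1(A(G))$. $\hat{A}(G,v)$ is the matrix obtained from $A(G)$ by replacing the diagonal entry corresponding to $v$ by $-1$. An end-edge of a tree is an edge one of whose endpoints has valency $1$. Vertices of the line graph of $T$ are the edges of $T$, adjacent when they share an endpoint.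
   Formalization: The formal theorem assumes the underlying graph of G is connected; without this the claim is false: for G a positive edge plus an isolated vertex v, the smallest eigenvalues of A(G) and Â(G,v) are both −1, and G is not the line graph of a tree. *)

(* Defs.v *)
From HB Require Import structures.
From mathcomp Require Import all_boot all_order all_algebra.
From mathcomp Require Import boolp classical_sets reals.
From mathcomp Require complex polyrcf.

Set Implicit Arguments.
Unset Strict Implicit.
Unset Printing Implicit Defensive.

Import Order.TTheory GRing.Theory Num.Theory.
Local Open Scope ring_scope.

Record sgraph (V : finType) := SGraph {
  edges : {set {set V}};
  edges_card2 : forall e, e \in edges -> #|e| = 2%N }.

Record esgraph (V : finType) := ESGraph {
  pos_edges : {set {set V}};
  neg_edges : {set {set V}};
  pos_edges_card2 : forall e, e \in pos_edges -> #|e| = 2%N;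
  neg_edges_card2 : forall e, e \in neg_edges -> #|e| = 2%N;
  pos_neg_disjoint : [disjoint pos_edges & neg_edges] }.

Lemma underlying_card2 (V : finType) (G : esgraph V) e :
  e \in pos_edges G :|: neg_edges G -> #|e| = 2%N.
Proof.
by rewrite inE => /orP[/pos_edges_card2 | /neg_edges_card2].
Qed.

Definition underlying (V : finType) (G : esgraph V) : sgraph V :=
  SGraph (@underlying_card2 V G).

(* No test for x != y is needed: [set x; x] does not have two elements. *)
Definition adj (V : finType) (H : sgraph V) : rel V :=
  fun x y => [set x; y] \in edges H.

Definition connected_graph (V : finType) (H : sgraph V) : Prop :=
  (0 < #|V|)%N /\ (forall x y : V, connect (adj H) x y).

(* [ucycle] accepts the two-element sequence [:: x; y] for adjacent x and y;
   the cycles of a simple graph are those of length at least 3. *)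
Definition acyclic_graph (V : finType) (H : sgraph V) : Prop :=
  forall p : seq V, ucycle (adj H) p -> (size p < 3)%N.

Definition tree (V : finType) (H : sgraph V) : Prop :=
  connected_graph H /\ acyclic_graph H.

Definition valency (V : finType) (H : sgraph V) (x : V) : nat :=
  #|[set y | adj H x y]|.

Definition end_edge (V : finType) (H : sgraph V) (e : {set V}) : Prop :=
  e \in edges H /\ exists2 x, x \in e & valency H x = 1%N.

Definition edge_type (V : finType) (H : sgraph V) : finType :=
  {e : {set V} | e \in edges H}.

Definition line_edges (V : finType) (H : sgraph V) : {set {set edge_type H}} :=
  [set p : {set edge_type H} |
     (#|p| == 2%N) && [exists x, [forall e in p, x \in val e]]].

Lemma line_edges_card2 (V : finType) (H : sgraph V) p :
  p \in line_edges H -> #|p| = 2%N.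
Proof. by rewrite inE => /andP[/eqP]. Qed.

Definition line_graph (V : finType) (H : sgraph V) : sgraph (edge_type H) :=
  SGraph (@line_edges_card2 V H).

Definition graph_iso (V W : finType) (H : sgraph V) (K : sgraph W)
    (f : V -> W) : Prop :=
  bijective f /\ (forall x y : V, adj K (f x) (f y) = adj H x y).

Definition line_graph_of_tree_at_end_edge (V : finType) (H : sgraph V)
    (v : V) : Prop :=
  exists (W : finType) (T : sgraph W) (f : V -> edge_type T),
    [/\ tree T, graph_iso H (line_graph T) f & end_edge T (val (f v))].

Definition adjmx (R : realType) (V : finType) (G : esgraph V) : 'M[R]_#|V| :=
  \matrix_(i, j) (if [set enum_val i; enum_val j] \in pos_edges G then 1
                  else if [set enum_val i; enum_val j] \in neg_edges G then -1
                  else 0).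

Definition adjmx_hat (R : realType) (V : finType) (G : esgraph V) (v : V) :
    'M[R]_#|V| :=
  \matrix_(i, j) (if (i == enum_rank v) && (j == enum_rank v) then -1
                  else adjmx R G i j).

(* For a real symmetric matrix of positive size the set of eigenvalues is
   finite and nonempty, so the infimum is a minimum: see [lambda1_min]. *)
Definition lambda1 (R : realType) (n : nat) (A : 'M[R]_n) : R :=
  inf [set a : R | eigenvalue A a]%classic.

Section Lambda1Min.
Import complex.

Lemma sym_eigenvalue_exists (R : realType) (n : nat) (A : 'M[R]_n) :
  (0 < n)%N -> A^T = A -> exists a, eigenvalue A a.
Proof.
move=> n0 symA; set B := map_mx (real_complex R) A.
have [z zB] := @eigenvalue_closed (complex R) n B n0.
have /eigenvalueP[x xB x0] := zB.
pose y := map_mx Num.conj x.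
have xBy : x *m B *m y^T = z *: (x *m y^T) by rewrite xB scalemxAl.
have BC : map_mx Num.conj B = B.
  by apply/matrixP => i j; rewrite !mxE; apply/CrealP/complex_realP; exists (A i j).
have BT : B^T = B by apply/matrixP => i j; rewrite !mxE -[in LHS]symA mxE.
have yB : y *m B = z^* *: y by rewrite -[in LHS]BC -map_mxM xB map_mxZ.
have By : B *m y^T = z^* *: y^T by rewrite -[in LHS]BT -trmx_mul yB linearZ.
have : (z - z^*) *: (x *m y^T) = 0.
  by rewrite scalerBl -xBy -mulmxA By -scalemxAr subrr.
move/matrixP => /(_ 0 0); rewrite !mxE => /eqP; rewrite mulf_eq0 => /orP[|].
  rewrite subr_eq0 eq_sym => /eqP/CrealP/complex_realP[r zr].
  by exists r; rewrite zr eigenvalue_map in zB.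
rewrite psumr_eq0 => [/allP h|i _]; last by rewrite !mxE mul_conjC_ge0.
case/eqP: x0; apply/rowP => i; apply/eqP.
by have := h i (mem_index_enum i); rewrite !mxE mul_conjC_eq0.
Qed.

Lemma lambda1_min (R : realType) (n : nat) (A : 'M[R]_n) :
  (0 < n)%N -> A^T = A ->
  eigenvalue A (lambda1 A) /\ (forall a, eigenvalue A a -> lambda1 A <= a).
Proof.
move=> n0 symA; have [a0 Aa0] := sym_eigenvalue_exists n0 symA.
have p0 : char_poly A != 0 by rewrite monic_neq0 ?char_poly_monic.
set s := polyrcf.rootsR (char_poly A).
have sE a : (a \in s) = eigenvalue A a.
  by rewrite eigenvalue_root_char -polyrcf.roots_on_rootsR // in_itv.
have ss : sorted <=%R s by apply: (sub_sorted (@ltW _ R)); apply: polyrcf.sorted_roots.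
have [m ms mmin] : exists2 m, m \in s & forall a, a \in s -> m <= a.
  move: Aa0; rewrite -sE; case: s {sE} ss => // m s' /= ss _.
  exists m; first exact: mem_head.
  move=> a; rewrite inE => /predU1P[->//|].
  exact: (allP (order_path_min le_trans ss)).
suff -> : lambda1 A = m by split=> [|a]; rewrite -?sE //; exact: mmin.
apply/eqP; rewrite eq_le; apply/andP; split.
  apply: ge_inf; last by rewrite /= -sE.
  by exists m => a /=; rewrite -sE; exact: mmin.
apply: lb_le_inf; first by exists a0.
by move=> a /=; rewrite -sE; exact: mmin.
Qed.

End Lambda1Min.

(* Main.v *)
Require Import Defs.
From mathcomp Require Import all_boot all_order all_algebra.
From mathcomp Require Import reals.
From mathcomp Require complex.
From mathcomp Require Import ring lra zify.

(** Let A be the signed adjacency matrix, A^ the matrix with diagonal entry -1 at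
    v, and M = A^ + 2, which has diagonal entries 2 except for a 1 at v. By the
    Rayleigh principle ([lambda1_gtP]), lambda1 A^ > -2 means that M is positive
    definite.

    Suppose it is. Then M is the Gram matrix of an integral lattice with a basis
    consisting of one vector of norm 1, at v, and vectors of norm 2. Starting
    from v and adding adjacent vertices one at a time ([unit_basis_exists]), one
    finds an orthonormal basis b_w of the lattice and a parent p w of each
    w other than v, such that the basis vector at w is b_w - b_(p w) up to
    sign, while at v it is b_v. Thus the vertices of G are the edges of a rooted
    tree, v being the edge from b_v to an additional leaf, and two vertices of G
    are adjacent exactly if the edges share an endpoint ([unit_basis_meet]).

    Conversely, let the underlying graph be the line graph of a tree T. As A + 2
    is positive definite, every triangle of G is positive, so the edges at each
    vertex of T carry signs inducing those of G. Hence A + 2 is the Gram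
    matrix of the columns of a signed incidence matrix of T ([mxform_inc]).
    Subtracting 1 at an end-edge v deletes the row of a leaf of T, and the remaining
    rows still have independent columns, since a nonempty forest has
    a leaf different from any prescribed vertex ([posdef_drop_leaf]).

    The strict inequality is immediate if lambda1 A^ <= -2. Otherwise the basis
    b_w exists, and shows that the inverse of M is, after switching,
    a nonnegative matrix with a positive row at v. By a Perron argument, no
    eigenvector of M for its smallest eigenvalue vanishes at v
    ([min_eigenvector_root]), which is what equality would require. *)

Set Implicit Arguments.
Unset Strict Implicit.
Unset Printing Implicit Defensive.

Import Order.TTheory GRing.Theory Num.Theory.
Local Open Scope ring_scope.

(** * Quadratic forms and the smallest eigenvalue *)

Section Form.
Variables (R : comNzRingType) (n : nat).
Implicit Types (M N : 'M[R]_n) (x y z : 'rV[R]_n).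

Definition mxform M x y : R := (x *m M *m y^T) 0 0.

Local Notation d i := (delta_mx 0 i : 'rV[R]_n).

Lemma mxformDl M x y z : mxform M (x + y) z = mxform M x z + mxform M y z.
Proof. by rewrite /mxform !mulmxDl mxE. Qed.

Lemma mxformZl M a x z : mxform M (a *: x) z = a * mxform M x z.
Proof. by rewrite /mxform -!scalemxAl mxE. Qed.

Lemma mxformBl M x y z : mxform M (x - y) z = mxform M x z - mxform M y z.
Proof. by rewrite mxformDl -scaleN1r mxformZl mulN1r. Qed.

Lemma mxformC M x y : M^T = M -> mxform M x y = mxform M y x.
Proof.
move=> sM; have tr (X : 'M[R]_1) : X 0 0 = X^T 0 0 by rewrite mxE.
by rewrite /mxform tr !trmx_mul trmxK sM mulmxA.
Qed.

Lemma mxformDr M x y z : mxform M z (x + y) = mxform M z x + mxform M z y.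
Proof. by rewrite /mxform linearD mulmxDr mxE. Qed.

Lemma mxformZr M a x z : mxform M z (a *: x) = a * mxform M z x.
Proof. by rewrite /mxform linearZ -!scalemxAr mxE. Qed.

Lemma mxformBr M x y z : mxform M z (x - y) = mxform M z x - mxform M z y.
Proof. by rewrite mxformDr -scaleN1r mxformZr mulN1r. Qed.

Lemma mxform0l M z : mxform M 0 z = 0.
Proof. by rewrite /mxform !mul0mx mxE. Qed.

Lemma mxform0r M z : mxform M z 0 = 0.
Proof. by rewrite /mxform trmx0 mulmx0 mxE. Qed.

Lemma mxform_delta M i j : mxform M (d i) (d j) = M i j.
Proof. by rewrite /mxform -rowE trmx_delta -colE !mxE. Qed.

Lemma mxformE M x y : mxform M x y = \sum_i \sum_j x 0 i * M i j * y 0 j.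
Proof.
rewrite /mxform mxE exchange_big; apply: eq_bigr => j _.
by rewrite !mxE big_distrl.
Qed.

Lemma mxformDM M N x y : mxform (M + N) x y = mxform M x y + mxform N x y.
Proof. by rewrite /mxform mulmxDr mulmxDl mxE. Qed.

Lemma mxform_scalar a x y : mxform a%:M x y = a * (x *m y^T) 0 0.
Proof. by rewrite /mxform mul_mx_scalar -scalemxAl mxE. Qed.

Lemma mxformBscalar M a x :
  mxform (M - a%:M) x x = mxform M x x - a * (x *m x^T) 0 0.
Proof. by rewrite mxformDM -scaleN1r scale_scalar_mx mxform_scalar !mulN1r mulNr. Qed.

End Form.

Lemma sqnorm (R : comNzRingType) n (x : 'rV[R]_n) : (x *m x^T) 0 0 = \sum_i x 0 i ^+ 2.
Proof. by rewrite mxE; apply: eq_bigr => i _; rewrite mxE expr2. Qed.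

Lemma sqnorm_ge0 (R : realDomainType) n (x : 'rV[R]_n) : 0 <= (x *m x^T) 0 0.
Proof. by rewrite sqnorm sumr_ge0 // => i _; exact: sqr_ge0. Qed.

Lemma sqnorm_gt0 (R : realDomainType) n (x : 'rV[R]_n) :
  x != 0 -> 0 < (x *m x^T) 0 0.
Proof.
move=> x0; rewrite sqnorm lt_def sumr_ge0 ?andbT => [|i _]; last exact: sqr_ge0.
rewrite psumr_eq0 => [|i _]; last exact: sqr_ge0.
apply: contraNN x0 => /allP h; apply/eqP/rowP => i; apply/eqP.
by have := h i (mem_index_enum i); rewrite /= sqrf_eq0 mxE.
Qed.

Definition posdef (R : numDomainType) n (M : 'M[R]_n) :=
  forall x : 'rV_n, x != 0 -> 0 < mxform M x x.

Section Rayleigh.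
Import complex.
Variable R : realType.
Local Notation C := (complex R).

(** Over the complex numbers A is unitarily diagonalizable and its spectrum is
    real, so in the eigenbasis the form is a sum of squares weighted by
    eigenvalues of A, each at least lambda1 A. *)
Lemma rayleigh n (A : 'M[R]_n) (x : 'rV[R]_n) : A^T = A ->
  lambda1 A * (x *m x^T) 0 0 <= mxform A x x.
Proof.
case: n => [|n] in A x *.
  by move=> _; rewrite /mxform !thinmx0 !mul0mx !mxE mulr0.
move=> sA; have [_ lamP] := lambda1_min (ltn0Sn n) sA.
set lam := lambda1 A in lamP *.
set B := map_mx (real_complex R) A; set u := map_mx (real_complex R) x.
have realC (m1 m2 : nat) (Y : 'M[R]_(m1, m2)) :
    map_mx Num.conj (map_mx (real_complex R) Y) = map_mx (real_complex R) Y.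
  by apply/matrixP => i j; rewrite !mxE; apply/CrealP/complex_realP; eexists.
have hB : B \is hermsymmx.
  by apply/is_hermitianmxP; rewrite expr0 scale1r /B map_trmx sA realC.
have := hermitian_spectral_diag_real hB.
have /orthomx_spectralP := hermitian_normalmx hB.
set P := spectralmx B; set D := spectral_diag B.
have uP : P \is unitarymx by exact: spectral_unitarymx.
rewrite invmx_unitary // => BE /mxOverP Dreal.
have lamD i : (lam%:C <= D 0 i)%C.
  have /complex_realP[r rE] := Dreal 0 i; rewrite rE lecR; apply: lamP.
  rewrite -(eigenvalue_map (real_complex R)) /= -[(r%:C)%C]rE.
  apply/eigenvalueP; exists (row i P).
    rewrite -/B BE -row_mul mulmxA mulmxA (unitarymxP uP) mul1mx.
    by rewrite row_mul row_diag_mx -scalemxAl -rowE.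
  apply/eqP => P0; have /unitarymxP/matrixP/(_ i i) := uP.
  rewrite mxE big1 => [|k _].
    by rewrite !mxE eqxx => /esym/eqP; rewrite oner_eq0.
  by move/rowP/(_ k): P0; rewrite !mxE => ->; rewrite mul0r.
have ut : (u^t*)%sesqui = u^T by rewrite map_trmx realC.
set z := (u *m P^t*)%sesqui.
have zt : (z^t*)%sesqui = (P *m u^T).
  by rewrite trmx_mul map_mxM -!map_trmx trmxK -map_mx_comp (map_mx_id (@conjCK _)) realC.
have form_u : ((mxform A x x)%:C)%C = \sum_i D 0 i * `|z 0 i| ^+ 2.
  have -> : ((mxform A x x)%:C)%C = (u *m B *m u^T) 0 0.
    by rewrite /mxform /u /B map_trmx -!map_mxM [RHS]mxE.
  rewrite BE !mulmxA -/z -mulmxA -zt mxE; apply: eq_bigr => i _.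
  by rewrite mul_mx_diag !mxE normCK mulrAC mulrA mulrC mulrA.
have norm_u : (((x *m x^T) 0 0)%:C)%C = \sum_i `|z 0 i| ^+ 2.
  have -> : (((x *m x^T) 0 0)%:C)%C = (u *m u^T) 0 0.
    by rewrite /u map_trmx -!map_mxM [RHS]mxE.
  have PP : (P^t* *m P)%sesqui = 1%:M by apply/mulmx1C/unitarymxP.
  have -> : u *m u^T = (z *m z^t*)%sesqui by rewrite zt /z mulmxA -(mulmxA u) PP mulmx1.
  rewrite mxE; apply: eq_bigr => i _.
  by rewrite !mxE normCK.
rewrite -lecR rmorphM /= form_u norm_u mulr_sumr; apply: ler_sum => i _.
by rewrite ler_wpM2r ?exprn_ge0.
Qed.

(** The only form in which the smallest eigenvalue is used below: bounds on it
    become positive definiteness of a shifted matrix. *)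
Lemma lambda1_gtP n (A : 'M[R]_n) c : (0 < n)%N -> A^T = A ->
  c < lambda1 A <-> posdef (A - c%:M).
Proof.
move=> n0 sA.
split=> [lt_c x x0 | pd].
  rewrite mxformBscalar subr_gt0; apply: lt_le_trans (rayleigh x sA).
  by rewrite ltr_pM2r ?sqnorm_gt0.
have [/eigenvalueP[x xA x0] _] := lambda1_min n0 sA.
have := pd x x0; rewrite mxformBscalar /mxform xA -scalemxAl mxE -mulrBl.
by rewrite pmulr_lgt0 ?sqnorm_gt0 // subr_gt0.
Qed.
End Rayleigh.

(** * Orthonormal bases indexed by a rooted tree *)

(** A rooted tree on [S] and one extra vertex [None], the parent of [v]; the
    rank [r] makes the parent relation well founded. *)
Record parent_tree (n : nat) (S : {set 'I_n}) (v : 'I_n)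
    (p : 'I_n -> option 'I_n) (r : 'I_n -> nat) : Prop := ParentTree {
  parent_root : p v = None;
  parent_None : forall i, i \in S -> p i = None -> i = v;
  parent_Some : forall i j, i \in S -> p i = Some j -> j \in S /\ (r j < r i)%N }.

(** An orthonormal family for the form M in which the standard basis vectors
    become, up to sign, the edges [b i - b (p i)] of the tree, with 0 attached to
    the root [None]. Support and integrality let the family be extended by
    one more vertex. *)
Record unit_basis (R : realType) (n : nat) (M : 'M[R]_n) (S : {set 'I_n})
    (p : 'I_n -> option 'I_n) (e : 'I_n -> R) (b : 'I_n -> 'rV[R]_n) : Prop :=
  UnitBasis {
  sign_sqr : forall i, i \in S -> e i ^+ 2 = 1;
  sign_delta : forall i, i \in S -> e i *: delta_mx 0 i = b i - oapp b 0 (p i);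
  basis_orthonormal :
    forall i j, i \in S -> j \in S -> mxform M (b i) (b j) = (i == j)%:R;
  basis_support : forall i x, i \in S -> x \notin S -> b i 0 x = 0;
  basis_int : forall i j, i \in S -> b i 0 j \is a Num.int }.

Lemma mxform_int (R : realType) n (M : 'M[R]_n) (x y : 'rV[R]_n) :
  (forall i j, M i j \is a Num.int) -> (forall i, x 0 i \is a Num.int) ->
  (forall i, y 0 i \is a Num.int) -> mxform M x y \is a Num.int.
Proof.
move=> Mi xi yi; rewrite mxformE; apply: rpred_sum => i _; apply: rpred_sum => j _.
by rewrite !rpredM.
Qed.

Lemma int_sqr_lt1 (R : realType) (c : R) : c \is a Num.int -> c ^+ 2 < 1 -> c = 0.
Proof.
move=> /intrP[m ->]; rewrite -rmorphXn -[1]/(1%:~R) ltr_int => h.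
have -> : m = 0 by nia.
by [].
Qed.

Lemma int_sqr_lt2 (R : realType) (c : R) : c \is a Num.int -> c ^+ 2 < 2 ->
  c = 0 \/ c ^+ 2 = 1.
Proof.
move=> /intrP[m ->]; rewrite -rmorphXn -[2]/(2%:~R) ltr_int => h.
have [->|[->|->]] : m = 0 \/ m = 1 \/ m = -1 by nia.
- by left.
- by right.
- by right; rewrite sqrrN.
Qed.

Section Grow.
Variables (R : realType) (n : nat) (M : 'M[R]_n) (v : 'I_n).
Hypotheses (sM : M^T = M) (pd : posdef M).
Hypothesis intM : forall i j, M i j \is a Num.int.
Hypotheses (Mv : M v v = 1) (Mi : forall i, i != v -> M i i = 2).
Local Notation d i := (delta_mx 0 i : 'rV[R]_n).

Lemma unit_basis1 : parent_tree [set v] v (fun=> None) (fun=> 0%N) /\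
  unit_basis M [set v] (fun=> None) (fun=> 1) (fun i => d i).
Proof.
split; first by split=> //= i; rewrite inE => /eqP.
split=> //= [i _|i _|i j|i x|i j].
- by rewrite expr1n.
- by rewrite scale1r subr0.
- by rewrite !inE => /eqP-> /eqP->; rewrite mxform_delta eqxx.
- by rewrite !inE => /eqP-> /negPf xv; rewrite mxE xv andbF.
- by move=> _; rewrite mxE; case: (_ && _).
Qed.

(** Extension by a vertex w with M w i != 0 for some i in S. Since delta_i is a
    signed sum of at most two members of the family, delta_w has a nonzero
    product c with some b_k. Positivity of delta_w - c b_k, whose form is 2 - c^2, gives c = 1 or -1;
    then b' = b_k - c delta_w has form 1. Its product m with each b_j is an
    integer, and b' - m b_j has form 1 - m^2, which is positive, so m = 0. The
    vectors concerned are nonzero because their coordinate at w is nonzero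
    while the b_j are supported in S. *)
Lemma unit_basis_grow (S : {set 'I_n}) p r e b i w : v \in S -> parent_tree S v p r ->
  unit_basis M S p e b -> i \in S -> w \notin S -> M w i != 0 ->
  exists p' r' e' b', parent_tree (w |: S) v p' r' /\ unit_basis M (w |: S) p' e' b'.
Proof.
move=> vS tP bP iS wS Mwi.
have wv : w != v by apply: contraNneq wS => ->.
have neqS j : j \in S -> (j == w) = false.
  by move=> jS; apply: contraNF wS => /eqP<-.
have [k kS ck0] : exists2 k, k \in S & mxform M (d w) (b k) != 0.
  have [/eqP b0|] := boolP (mxform M (d w) (b i) == 0); last by exists i.
  have : e i * M w i = - mxform M (d w) (oapp b 0 (p i)).
    by rewrite -mxform_delta -mxformZr (sign_delta bP) // mxformBr b0 sub0r.
  case pi: (p i) => [k|] /=.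
    exists k; first by have [] := parent_Some tP iS pi.
    apply: contraNneq Mwi => k0; have := sign_sqr bP iS.
    by move: H; rewrite k0 oppr0 => /eqP; rewrite mulf_eq0 => /predU1P[->|//];
      rewrite expr0n /= => /esym/eqP; rewrite oner_eq0.
  rewrite mxform0r oppr0 => /eqP; rewrite mulf_eq0 (negPf Mwi) orbF => /eqP e0.
  by have := sign_sqr bP iS; rewrite e0 expr0n => /esym/eqP; rewrite oner_eq0.
set c := mxform M (d w) (b k) in ck0.
have dint j : d w 0 j \is a Num.int by rewrite mxE; case: (_ && _).
have cint : c \is a Num.int by apply: mxform_int => // j; by apply: (basis_int bP).
have bw j : j \in S -> b j 0 w = 0 by move=> jS; apply: (basis_support bP).
have Mww : mxform M (d w) (d w) = 2 by rewrite mxform_delta Mi.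
have bb j : j \in S -> mxform M (b j) (b j) = 1.
  by move=> jS; rewrite (basis_orthonormal bP) ?eqxx.
have c2 : c ^+ 2 = 1.
  have : 0 < mxform M (d w - c *: b k) (d w - c *: b k).
    apply: pd; apply/eqP => /rowP/(_ w); rewrite !mxE bw // !eqxx mulr0 subr0.
    by move/eqP; rewrite oner_eq0.
  rewrite mxformBl !mxformBr !mxformZl !mxformZr (mxformC (b k) (d w)) // -/c Mww bb // => h.
  have c22 : c ^+ 2 < 2 by lra.
  by have [c00|//] := int_sqr_lt2 cint c22; rewrite c00 eqxx in ck0.
have [b' b'E] : exists b', b' = b k - c *: d w by eexists.
have b'1 : mxform M b' b' = 1.
  rewrite b'E mxformBl !mxformBr !mxformZl !mxformZr (mxformC (b k) (d w)) // -/c Mww bb //.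
  lra.
have b'int j : b' 0 j \is a Num.int.
  rewrite b'E !mxE; apply: rpredB; first exact: (basis_int bP).
  apply: rpredM; first exact: cint.
  by case: (_ && _); rewrite ?rpred1 ?rpred0.
have b'o j : j \in S -> mxform M b' (b j) = 0.
  move=> jS; set m := mxform M b' (b j).
  have mint : m \is a Num.int by apply: mxform_int => // l; by apply: (basis_int bP).
  have : 0 < mxform M (b' - m *: b j) (b' - m *: b j).
    apply: pd; apply/eqP => /rowP/(_ w); rewrite b'E !mxE !bw // !eqxx mulr0 subr0 mulr1 sub0r.
    by move/eqP; rewrite oppr_eq0 (negPf ck0).
  rewrite mxformBl !mxformBr !mxformZl !mxformZr (mxformC (b j) b') // -/m b'1 bb // => h.
  by apply: int_sqr_lt1 => //; lra.
exists (fun x => if x == w then Some k else p x),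
       (fun x => if x == w then (r k).+1 else r x),
       (fun x => if x == w then - c else e x),
       (fun x => if x == w then b' else b x).
split; split.
- by rewrite eq_sym (negPf wv) (parent_root tP).
- move=> x; rewrite !inE; case: eqP => //= _ xS; exact: (parent_None tP).
- move=> x y; rewrite !inE; case: eqP => /= [_ _ [<-]|_ xS px].
    by rewrite kS orbT neqS.
  by have [yS ry] := parent_Some tP xS px; rewrite yS orbT neqS.
- by move=> x; rewrite !inE; case: eqP => /= [_ _|_ /(sign_sqr bP)//]; rewrite sqrrN.
- move=> x; rewrite !inE; case: eqP => /= [-> _|_ xS].
    by rewrite neqS // b'E addrAC subrr sub0r scaleNr.
  rewrite (sign_delta bP) //; case px: (p x) => [y|] //=.
  by have [yS _] := parent_Some tP xS px; rewrite neqS.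
- move=> x y; rewrite !inE; case: (eqVneq x w) => [->|_] /= xS;
    case: (eqVneq y w) => [->|yw] /= yS.
  + exact: b'1.
  + by rewrite b'o // eq_sym (negPf yw).
  + by rewrite mxformC // b'o // neqS.
  + exact: (basis_orthonormal bP).
- move=> x y; rewrite !inE negb_or => xS /andP[yw yS].
  have b0 j : j \in S -> b j 0 y = 0 by move=> jS; apply: (basis_support bP).
  case: eqP xS => /= [_ _|_ /b0//].
  by rewrite b'E !mxE b0 // (negPf yw) mulr0 subr0.
- move=> x y; rewrite !inE; case: eqP => //= _ xS; exact: (basis_int bP).
Qed.

Lemma unit_basis_exists : (forall i j, connect [rel i j | M i j != 0] i j) ->
  exists p r e b, parent_tree setT v p r /\ unit_basis M setT p e b.
Proof.
move=> conn.
(* Connectedness provides, as long as S is proper, a new vertex to attach. *)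
suff /(_ n) H : forall m, (0 < m <= n)%N -> exists (S : {set 'I_n}) p r e b,
    [/\ #|S| = m, v \in S, parent_tree S v p r & unit_basis M S p e b].
  have [|S [p [r [e [b [cS vS tP bP]]]]]] := H.
    by rewrite leqnn andbT; apply: leq_ltn_trans (ltn_ord v).
  exists p, r, e, b; suff <- : S = setT by [].
  by apply/eqP; rewrite eqEcard subsetT cardsT card_ord cS leqnn.
elim=> // m IH /andP[_ mn]; case: m => [|m] in IH mn *.
  have [tP bP] := unit_basis1.
  by do 5!eexists; split; [exact: cards1|exact: set11|exact: tP|exact: bP].
have [|S [p [r [e [b [cS vS tP bP]]]]]] := IH; first exact: ltnW.
have [w wS] : exists w, w \notin S.
  apply/existsP; rewrite -negb_forall; apply: contraL mn => /forallP/= h.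
  rewrite -leqNgt -cS -[X in (X <= _)%N]card_ord -cardsT subset_leq_card //.
  by apply/subsetP => x _.
have [i [x [iS xS Mix]]] : exists i x, [/\ i \in S, x \notin S & M i x != 0].
  have /connectP[q] := conn v w; elim: q (v) vS => [|y q IHq] z zS /=.
    by move=> _ wz; rewrite wz zS in wS.
  case/andP => Mzy /IHq {}IHq wq; have [/IHq/(_ wq)//|yS] := boolP (y \in S).
  by exists z, y.
have Mxi : M x i != 0 by rewrite -sM mxE.
have [p' [r' [e' [b' [tP' bP']]]]] := unit_basis_grow vS tP bP iS xS Mxi.
exists (x |: S), p', r', e', b'; split=> //; first by rewrite cardsU1 xS cS.
by rewrite inE vS orbT.
Qed.

End Grow.

(** * Minimal eigenvectors do not vanish at the root *)

Section Perron.
Variables (R : realType) (n : nat) (M : 'M[R]_n) (v : 'I_n).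
Variables (p : 'I_n -> option 'I_n) (r : 'I_n -> nat).
Variables (e : 'I_n -> R) (b : 'I_n -> 'rV[R]_n).
Hypotheses (tP : parent_tree setT v p r) (bP : unit_basis M setT p e b).

(** Unfolding b i = b (p i) + e i delta_i, the vector b i is the sum of
    e j delta_j over the ancestors j of i, i and the root v included. After
    switching by e, the orthonormal vectors are thus nonnegative, and positive
    at v. *)
Lemma basis_signed i : (forall j, 0 <= e j * b i 0 j) /\ 1 <= e v * b i 0 v.
Proof.
have [m] := ubnP (r i); elim: m i => // m IH i ri.
have e2 j : e j * e j = 1 by rewrite -expr2 (sign_sqr bP) ?inE.
have /rowP bi := sign_delta bP (in_setT i).
have {}bi j : b i 0 j = e i * (i == j)%:R + oapp b 0 (p i) 0 j.
  by have := bi j; rewrite !mxE eqxx eq_sym => ->; rewrite subrK.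
case pi: (p i) bi => [k|] /= bi.
  have [_ rk] := parent_Some tP (in_setT i) pi.
  have [k0 k1] := IH k (leq_trans rk ri).
  have pos j : 0 <= e j * (e i * (i == j)%:R).
    by case: eqP => [->|_]; rewrite ?mulr0 // mulr1 e2.
  split=> [j|]; rewrite bi mulrDr; first by rewrite addr_ge0.
  by apply: le_trans k1 _; rewrite lerDr.
have iv := parent_None tP (in_setT i) pi.
split=> [j|]; last by rewrite -iv bi mxE addr0 eqxx mulr1 e2.
by rewrite bi mxE addr0; case: eqP => [<-|_]; rewrite ?mulr0 // mulr1 e2.
Qed.

(** With B the matrix of rows b i, the inverse of M is B^T B, which after
    switching by e is nonnegative with a positive row at v. This is a
    Perron argument: if x_v = 0, replacing x by the vector of entries
    e_j |x_j| and adding a small positive entry t at v increases the quadratic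
    form of the inverse to first order in t, but the squared norm only by t^2.
    This exceeds the bound 1 / mu on the form of the inverse. *)
Lemma min_eigenvector_root mu (x : 'rV[R]_n) : 0 < mu ->
  (forall y : 'rV[R]_n, mu * (y *m y^T) 0 0 <= mxform M y y) ->
  x *m M = mu *: x -> x 0 v = 0 -> x = 0.
Proof.
move=> mu0 muP xM xv.
pose B : 'M[R]_n := \matrix_i b i.
have BMB : B *m M *m B^T = 1%:M.
  apply/matrixP => i j; rewrite [RHS]mxE -(basis_orthonormal bP) ?inE //.
  have bB k : b k = delta_mx 0 k *m B by rewrite -rowE rowK.
  by rewrite -mxform_delta /mxform !bB trmx_mul !mulmxA.
have MBB : M *m (B^T *m B) = 1%:M.
  by rewrite mulmxA; apply: mulmx1C; rewrite mulmxA.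
have BBM : B^T *m B *m M = 1%:M by exact: mulmx1C.
pose g (y : 'rV[R]_n) w := \sum_j y 0 j * b w 0 j.
have gE y : (y *m B^T *m (y *m B^T)^T) 0 0 = \sum_w g y w ^+ 2.
  by rewrite sqnorm; apply: eq_bigr => w _; rewrite !mxE; congr (_ ^+ 2);
     apply: eq_bigr => j _; rewrite !mxE.
(* Expand the square of y - mu u, where u = y M^-1, and use the bound at u. *)
have gle y : mu * (\sum_w g y w ^+ 2) <= (y *m y^T) 0 0.
  have := muP (y *m (B^T *m B)); set u := y *m (B^T *m B).
  have -> : mxform M u u = \sum_w g y w ^+ 2.
    have uM : u *m M = y by rewrite /u -mulmxA BBM mulmx1.
    rewrite -gE /mxform uM /u; congr (fun_of_matrix _ 0 0).
    by rewrite !trmx_mul !trmxK !mulmxA.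
  have := sqnorm_ge0 (y - mu *: u).
  rewrite linearB /= mulmxBl !mulmxBr linearZ /= -!scalemxAl -!scalemxAr.
  have uy : (u *m y^T) 0 0 = \sum_w g y w ^+ 2.
    by rewrite -gE trmx_mul trmxK /u !mulmxA.
  have yu : (y *m u^T) 0 0 = \sum_w g y w ^+ 2.
    by rewrite -uy [in RHS]mxE mxE; apply: eq_bigr => k _; rewrite !mxE mulrC.
  have entry (X Y Z W : 'M[R]_1) : (X - mu *: Y - (mu *: Z - mu *: (mu *: W))) 0 0
      = X 0 0 - mu * Y 0 0 - (mu * Z 0 0 - mu * (mu * W 0 0)) by rewrite !mxE.
  rewrite entry uy yu; nra.
have xg : x = mu *: (x *m (B^T *m B)).
  by rewrite scalemxAl -xM -mulmxA MBB mulmx1.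
have xgx : mu * (\sum_w g x w ^+ 2) = (x *m x^T) 0 0.
  have -> : x *m x^T = mu *: (x *m (B^T *m B) *m x^T) by rewrite scalemxAl -xg.
  by rewrite -gE [RHS]mxE trmx_mul trmxK !mulmxA.
(* This t makes the first-order gain 2 mu t S equal to 2 t^2. *)
pose S := \sum_w `|g x w|.
pose t := mu * S.
have S0 : 0 <= S by apply: sumr_ge0.
have t0 : 0 <= t by rewrite mulr_ge0 // ltW.
pose y : 'rV[R]_n := \row_j (e j * (`|x 0 j| + t * (j == v)%:R)).
have y2 : (y *m y^T) 0 0 = (x *m x^T) 0 0 + t ^+ 2.
  rewrite !sqnorm (bigD1 v) //= [in RHS](bigD1 v) //= xv !mxE xv normr0 eqxx.
  rewrite exprMn (sign_sqr bP) ?inE // add0r mul1r mulr1 expr0n add0r addrC.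
  congr (_ + _); apply: eq_bigr => j jv.
  by rewrite mxE exprMn (sign_sqr bP) ?inE // (negPf jv) mulr0 addr0 mul1r real_normK ?num_real.
have gy w : `|g x w| + t <= g y w.
  apply: le_trans (_ : \sum_j `|x 0 j| * `|b w 0 j| + t <= _).
    by rewrite lerD2r; apply: le_trans (ler_norm_sum _ _ _) _;
       apply: ler_sum => j _; rewrite normrM.
  have [pos ge1] := basis_signed w.
  have -> : g y w = \sum_j `|x 0 j| * `|b w 0 j| + t * (e v * b w 0 v).
    rewrite [X in _ + X](_ : _ = \sum_j (if j == v then t * (e j * b w 0 j) else 0)).
      rewrite -big_split; apply: eq_bigr => j _; rewrite mxE.
      have -> : `|b w 0 j| = e j * b w 0 j.
        rewrite -[RHS]ger0_norm // normrM.
        have : `|e j| ^+ 2 == 1 by rewrite real_normK ?num_real // (sign_sqr bP) ?inE.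
        by rewrite sqrp_eq1 // => /eqP->; rewrite mul1r.
      by case: eqP => _ /=; ring.
    by rewrite -big_mkcond big_pred1_eq.
  by rewrite lerD2l ler_peMr.
have := gle y; rewrite y2 -xgx => h.
have : \sum_w g y w ^+ 2 >= \sum_w g x w ^+ 2 + 2 * t * S.
  rewrite /S mulr_sumr -big_split; apply: ler_sum => w _ /=.
  rewrite -[g x w ^+ 2]real_normK ?num_real //.
  have := gy w; have := normr_ge0 (g x w); move: (`|g x w|) => a a0 ga.
  nra.
move=> h2; have {h h2} : mu * (2 * t * S) <= t ^+ 2 by nra.
have -> : mu * (2 * t * S) = 2 * t ^+ 2 by rewrite /t; ring.
move=> h; have {h} /eqP : t ^+ 2 = 0 by have := sqr_ge0 t; lra.
rewrite sqrf_eq0 mulf_eq0 (gt_eqF mu0) /= psumr_eq0 // => /allP gx0.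
rewrite xg mulmxA (_ : x *m B^T = 0) ?mul0mx ?scaler0 //.
apply/rowP => w; rewrite [RHS]mxE; have := gx0 w (mem_index_enum w).
rewrite normr_eq0 => /eqP gxw; rewrite -[RHS]gxw.
by rewrite mxE; apply: eq_bigr => j _; rewrite !mxE.
Qed.

End Perron.

(** * The graph of a parent function *)

Lemma set2_eq (T : finType) (x y a b : T) : [set x; y] = [set a; b] ->
  (x = a /\ y = b) \/ (x = b /\ y = a).
Proof.
move=> E; have := set21 x y; rewrite E !inE => /orP[] /eqP xE; subst x.
- left; split=> //; have := set22 a y; rewrite E !inE => /orP[/eqP ya|/eqP//].
  by have := set22 a b; rewrite -E ya !inE orbb => /eqP.
- right; split=> //; have := set22 b y; rewrite E !inE => /orP[/eqP //|/eqP yb].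
  by have := set21 a b; rewrite -E yb !inE orbb => /eqP.
Qed.

Lemma adj_sym (V : finType) (H : sgraph V) : symmetric (adj H).
Proof. by move=> x y; rewrite /adj setUC. Qed.

Lemma adj_line_graph (W : finType) (T : sgraph W) (e1 e2 : edge_type T) :
  adj (line_graph T) e1 e2 =
  (e1 != e2) && [exists x, (x \in val e1) && (x \in val e2)].
Proof.
rewrite /adj inE cards2 eqSS eqb1; congr (_ && _); apply: eq_existsb => x.
apply/forall_inP/andP => [h|[h1 h2] e]; first by rewrite !h ?set21 ?set22.
by rewrite !inE => /orP[] /eqP->.
Qed.

Section ParentGraph.
Variables (n : nat) (v : 'I_n) (p : 'I_n -> option 'I_n) (r : 'I_n -> nat).
Hypothesis tP : parent_tree setT v p r.

(** Every edge is obtained once, so the edges of the tree are indexed by its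
    vertices other than [None]. *)
Definition parent_edge i : {set option 'I_n} := [set Some i; p i].

Lemma parent_lt i j : p i = Some j -> (r j < r i)%N.
Proof. by move/(parent_Some tP (in_setT i)) => []. Qed.

Lemma parent_edge_card2 E : E \in [set parent_edge i | i : 'I_n] -> #|E| = 2%N.
Proof.
case/imsetP => i _ ->; rewrite cards2; case: eqP => // /esym/parent_lt.
by rewrite ltnn.
Qed.

Definition parent_graph : sgraph (option 'I_n) := SGraph parent_edge_card2.

Lemma parent_edge_inj : injective parent_edge.
Proof.
move=> i j /set2_eq[[[]]//|[/esym/parent_lt ij /parent_lt ji]].
by have := ltn_trans ij ji; rewrite ltnn.
Qed.

Lemma adj_parentP x y : reflect
  (exists i, (x = Some i /\ y = p i) \/ (y = Some i /\ x = p i))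
  (adj parent_graph x y).
Proof.
apply: (iffP imsetP) => [[i _ /set2_eq[]]|[i E]].
- by case=> -> ->; exists i; left.
- by case=> -> ->; exists i; right.
- by exists i => //; case: E => -[-> ->] //; rewrite setUC.
Qed.

(** Iterating the parent function reaches [None]. On a cycle, both neighbours of
    a vertex of largest rank would be its parent, hence equal. *)
Lemma parent_graph_tree : tree parent_graph.
Proof.
pose rk (x : option 'I_n) := oapp (fun i => (r i).+1) 0%N x.
have rk_parent i : (rk (p i) < rk (Some i))%N.
  by rewrite /rk; case pi: (p i) => [j|] //=; rewrite ltnS parent_lt.
have up x y : adj parent_graph x y -> (rk y <= rk x)%N ->
    exists2 i, x = Some i & y = p i.
  case/adj_parentP => i [[-> ->]|[-> ->]]; first by exists i.
  by rewrite leqNgt rk_parent.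
split; first split.
- by rewrite card_option.
- have to_root x : connect (adj parent_graph) x None.
    have [m] := ubnP (rk x); elim: m x => // m IH [i|] xm; last exact: connect0.
    apply: (@connect_trans _ _ (p i)); last by apply: IH; exact: leq_trans (rk_parent i) xm.
    by apply/connect1/adj_parentP; exists i; left.
  move=> x y; apply: (connect_trans (to_root x)).
  by rewrite (sym_connect_sym (@adj_sym _ _)).
- move=> c /andP[cc uc]; rewrite ltnNge; apply/negP => c3.
  have [x0 x0c] : exists x0, x0 \in c.
    by case: c c3 {cc uc} => // x0 c _; exists x0; exact: mem_head.
  have [x xc xmax] := arg_maxnP rk x0c.
  have [k q cE] := rot_to xc.
  have {cc} : cycle (adj parent_graph) (x :: q) by rewrite -cE rot_cycle.
  have {uc} : uniq (x :: q) by rewrite -cE rot_uniq.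
  have {c3} : (2 < size (x :: q))%N by rewrite -cE size_rot.
  have {xmax} : forall y, y \in x :: q -> (rk y <= rk x)%N.
    by move=> y; rewrite -cE mem_rot; exact: xmax.
  case: q {cE} => [|y [|z q]] // xmax _ /andP[_ /andP[yq _]] /= /andP[xy].
  rewrite rcons_path => /andP[_ /andP[_]].
  set l := last z q => lx; have lq : l \in z :: q by exact: mem_last.
  have [|i xi yi] := up _ _ xy; first by apply: xmax; rewrite !inE eqxx orbT.
  rewrite adj_sym in lx.
  have [|j] := up _ _ lx; first by apply: xmax; rewrite !inE -in_cons lq !orbT.
  by rewrite xi => -[<-] li; rewrite yi -li lq in yq.
Qed.

Lemma valency_root : valency parent_graph None = 1%N.
Proof.
rewrite /valency (_ : [set y | _] = [set Some v]) ?cards1 //.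
apply/setP => y; rewrite !inE; apply/adj_parentP/eqP => [[i [[//]|[-> pi]]]|->].
  by congr Some; apply: (parent_None tP) => //.
by exists v; right; rewrite (parent_root tP).
Qed.

Lemma parent_edges_meetE i j : i != j ->
  [exists x, (x \in parent_edge i) && (x \in parent_edge j)] =
  [|| p i == Some j, p j == Some i | (p i == p j) && (p i != None)].
Proof.
move=> ij; apply/existsP/idP => [[x]|].
- rewrite !inE => /andP[/orP[] /eqP-> /orP[] /eqP E].
  + by case: E ij => ->; rewrite eqxx.
  + by rewrite -E eqxx orbT.
  + by rewrite E eqxx.
  + rewrite E eqxx; case pj: (p j) => [k|]; first by rewrite !orbT.
    have jv : j = v by exact: (parent_None tP).
    have iv : i = v by apply: (parent_None tP); rewrite ?inE ?E.
    by rewrite iv jv eqxx in ij.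
case/or3P => [/eqP E|/eqP E|/andP[/eqP E _]].
- by exists (Some j); rewrite !inE E !eqxx orbT.
- by exists (Some i); rewrite !inE E !eqxx orbT.
- by exists (p i); rewrite !inE E !eqxx !orbT.
Qed.

(** Up to sign, M i j is the product of b i - b (p i) and b j - b (p j). By
    orthonormality it is 1 or -1 exactly if the two edges share a vertex other
    than [None], and [None] lies on one edge only. The rank excludes
    cancellations, as two distinct edges cannot share both ends. *)
Lemma unit_basis_meet (R : realType) (M : 'M[R]_n) e b i j :
  unit_basis M setT p e b -> i != j ->
  (M i j != 0) = [exists x, (x \in parent_edge i) && (x \in parent_edge j)].
Proof.
move=> bP ij; rewrite parent_edges_meetE //.
have e0 k : e k != 0.
  apply/eqP => ek; have := sign_sqr bP (in_setT k).
  by rewrite ek expr0n => /esym/eqP; rewrite oner_eq0.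
have on x y : mxform M (oapp b 0 x) (oapp b 0 y) = ((x == y) && (x != None))%:R.
  case: x y => [x|] [y|] /=; rewrite ?mxform0l ?mxform0r //.
  by rewrite (basis_orthonormal bP) ?inE // andbT.
have : e i * e j * M i j = (0 - (Some i == p j)%:R) -
     ((p i == Some j)%:R - ((p i == p j) && (p i != None))%:R).
  rewrite -mxform_delta -mulrA -mxformZr -mxformZl !(sign_delta bP) ?inE //.
  rewrite mxformBl !mxformBr -[b i]/(oapp b 0 (Some i)) -[b j]/(oapp b 0 (Some j)) !on /=.
  rewrite !andbT [Some i == Some j](negPf ij).
  by case: (p i) => [k|]; rewrite ?andbT ?andbF.
have -> : (M i j != 0) = (e i * e j * M i j != 0).
  by rewrite !mulf_eq0 !(negPf (e0 _)).
move->; rewrite (eq_sym (Some i)); case: (eqVneq (p i) (Some j)) => [pi|_] /=.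
  rewrite pi; case: (eqVneq (p j) (Some i)) => [pj|_] /=.
    by have := ltn_trans (parent_lt pj) (parent_lt pi); rewrite ltnn.
  case: (eqVneq (Some j) (p j)) => [pj|_] /=.
    by have := parent_lt (esym pj); rewrite ltnn.
  by rewrite !subr0 sub0r oppr_eq0 oner_eq0.
case: (eqVneq (p j) (Some i)) => [pj|_] /=.
  rewrite pj; case: (eqVneq (p i) (Some i)) => [pi|_] /=.
    by have := parent_lt pi; rewrite ltnn.
  by rewrite !subr0 sub0r oppr_eq0 oner_eq0.
by rewrite !subr0 !sub0r opprK; case: (_ && _); rewrite ?oner_eq0 ?eqxx.
Qed.

End ParentGraph.

(** * Leaves of forests *)

Definition leaf_in (W : finType) (F : {set {set W}}) (y : W) :=
  exists2 E, E \in F & y \in E /\ (forall E', E' \in F -> y \in E' -> E' = E).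

Section Forest.
Variables (W : finType) (T : sgraph W) (F : {set {set W}}).
Hypotheses (acT : acyclic_graph T) (FT : F \subset edges T).
Let a : rel W := fun x y => [set x; y] \in F.

Let a_sym : symmetric a. Proof. by move=> x y; rewrite /a setUC. Qed.

Let F2 E : E \in F -> exists x y, x != y /\ E = [set x; y].
Proof.
move=> EF; have /eqP/cards2P[x [y [xy ->]]] := edges_card2 (subsetP FT _ EF).
by exists x, y.
Qed.

(** A further edge at the head would either prolong the path or close a cycle of
    length at least 3 in T. *)
Lemma longest_path_head_leaf x s : (0 < size s)%N -> uniq (x :: s) -> path a x s ->
  (forall s', uniq s' -> sorted a s' -> (size s' <= (size s).+1)%N) ->
  leaf_in F x.
Proof.
case: s => // z s _ us ps smax.
exists [set x; z]; first by case/andP: ps.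
split=> [|E EF xE]; first exact: set21.
have [y axy ->] : exists2 y, a x y & E = [set x; y].
  have [y1 [y2 [_ EE]]] := F2 EF; move: xE EF; rewrite EE !inE => /orP[] /eqP-> yF.
    by exists y2.
  by exists y1; [rewrite a_sym|rewrite setUC].
have xy : x != y.
  have := edges_card2 (subsetP FT _ axy); rewrite cards2; by case: (x != y).
have ays : y \in z :: s.
  apply: contraT => ys; have := smax [:: y, x, z & s]; rewrite ltnn; apply.
    by rewrite /= inE negb_or eq_sym xy ys.
  by rewrite /= (a_sym y) axy.
have subaT : subrel a (adj T) by move=> u w; exact: (subsetP FT).
have {ays} := ays; rewrite inE => /predU1P[->//|ys].
case/splitPr: ys us ps {smax} => p1 p2 us ps.
suff /acT : ucycle (adj T) (x :: z :: rcons p1 y) by rewrite /= size_rcons.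
apply/andP; split.
  apply: (sub_cycle subaT); move: ps; rewrite /= rcons_path cat_path /= last_rcons.
  by rewrite rcons_path (a_sym y) axy => /and4P[-> -> -> _].
apply: subseq_uniq us.
rewrite -cat_rcons; exact: (prefix_subseq [:: x, z & rcons p1 y] p2).
Qed.

(** Both ends of a longest path of F are leaves, and one of them differs from
    r. *)
Lemma forest_leaf (r : W) : F != set0 -> exists2 y, y != r & leaf_in F y.
Proof.
case/set0Pn => E EF.
pose P k := [exists t : k.-tuple W, uniq t && sorted a t].
have PP s : uniq s -> sorted a s -> P (size s).
  by move=> us ss; apply/existsP; exists (in_tuple s); rewrite us.
have Pub k : P k -> (k <= #|W|)%N.
  by case/existsP => t /andP[/card_uniqP ct _]; rewrite -(size_tuple t) -ct max_card.
have [x [y [xy EE]]] := F2 EF.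
have P2 : P 2 by apply: (PP [:: x; y]); rewrite /= ?inE ?xy // /a -EE EF.
have [m /existsP[t /andP[ut st]] mmax] := ex_maxnP (ex_intro P _ P2) Pub.
have m2 := mmax _ P2.
have mE := size_tuple t; move: (tval t) mE ut st => {}t mE ut st.
have tmax s : uniq s -> sorted a s -> (size s <= size t)%N.
  by move=> us ss; rewrite mE; apply: mmax; exact: PP.
have head_leaf z s : (1 < size (z :: s))%N -> uniq (z :: s) -> sorted a (z :: s) ->
    (forall s', uniq s' -> sorted a s' -> (size s' <= size (z :: s))%N) -> leaf_in F z.
  by move=> *; apply: (@longest_path_head_leaf z s).
case: t mE ut st tmax => [|z s] mE ut st tmax; first by rewrite -mE in m2.
have [zr|zr] := eqVneq z r; last first.
  by exists z => //; apply: (head_leaf z s); rewrite // mE.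
have revE : size (rev (z :: s)) = size (z :: s) by rewrite size_rev.
have ur : uniq (rev (z :: s)) by rewrite rev_uniq.
have sr : sorted a (rev (z :: s)).
  by rewrite rev_sorted; apply: sub_sorted st => u w; rewrite a_sym.
case: (lastP s) mE ut tmax revE ur sr {st} => [|s' l] mE ut tmax revE ur sr.
  by rewrite -mE in m2.
rewrite -rcons_cons rev_rcons in revE ur sr.
exists l; last by apply: (head_leaf _ _ _ ur sr); rewrite revE // mE.
by apply: contraTneq ut => ->; rewrite zr /= mem_rcons mem_head.
Qed.

End Forest.

(** * Signed line graphs and incidence matrices *)

Lemma valency1_edge (W : finType) (T : sgraph W) (r : W) (E E' : {set W}) :
  valency T r = 1%N -> E \in edges T -> E' \in edges T -> r \in E -> r \in E' ->
  E = E'.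
Proof.
move=> r1 ET E'T rE rE'.
have /eqP/cards1P[z zE] := r1.
suff aux X : X \in edges T -> r \in X -> X = [set r; z] by rewrite (aux E) // (aux E').
move=> XT; have /eqP/cards2P[a [b [_ XE]]] := edges_card2 XT.
have key u : [set r; u] \in edges T -> u = z.
  by move=> ru; apply/eqP; rewrite -in_set1 -zE inE.
rewrite XE in XT *; rewrite !inE => /orP[] /eqP rx; rewrite -rx in XT *.
  by rewrite (key b).
by rewrite setUC in XT *; rewrite (key a).
Qed.

Section Incidence.
Variables (R : realType) (W : finType) (T : sgraph W) (n : nat).
Variables (phi : 'I_n -> edge_type T) (A : 'M[R]_n).
Hypotheses (phi_inj : injective phi) (sA : A^T = A).
Hypothesis A2 : forall i j, A i j ^+ 2 = (adj (line_graph T) (phi i) (phi j))%:R.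
Hypothesis pdA : posdef (A - (-2)%:M).
Local Notation d i := (delta_mx 0 i : 'rV[R]_n).

Lemma A_sym i j : A i j = A j i. Proof. by rewrite -[in LHS]sA mxE. Qed.

Lemma A2_meet i j y : i != j -> y \in val (phi i) -> y \in val (phi j) ->
  A i j ^+ 2 = 1.
Proof.
move=> ij yi yj; rewrite A2 adj_line_graph (inj_eq phi_inj) ij /=.
by have -> : [exists x, (x \in val (phi i)) && (x \in val (phi j))]
  by apply/existsP; exists y; rewrite yi.
Qed.

Lemma A0_disjoint i j : i != j ->
  (forall y, y \in val (phi i) -> y \in val (phi j) -> false) -> A i j = 0.
Proof.
move=> ij dis; apply/eqP; rewrite -sqrf_eq0 A2 adj_line_graph (inj_eq phi_inj) ij andTb.
by case: existsP => // -[y /andP[yi yj]]; have := dis y yi yj.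
Qed.

Lemma A_diag i : A i i = 0.
Proof. by apply/eqP; rewrite -sqrf_eq0 A2 adj_line_graph eqxx. Qed.

(** Otherwise the form A + 2 vanishes at delta_i - A_ij delta_j - A_ik delta_k. *)
Lemma triangle_positive i j k : i != j -> i != k -> j != k ->
  A i j ^+ 2 = 1 -> A i k ^+ 2 = 1 -> A j k ^+ 2 = 1 -> A i j * A i k = A j k.
Proof.
move=> ij ik jk ij1 ik1 jk1.
suff : A i j * A i k * A j k != -1.
  have : (A i j * A i k * A j k) ^+ 2 == 1 by rewrite !exprMn ij1 ik1 jk1 !mulr1.
  rewrite sqrf_eq1 => /orP[/eqP h _|->//].
  by rewrite -[LHS]mulr1 -jk1 expr2 mulrA h mul1r.
apply/eqP => neg.
have := pdA (x := d i - A i j *: d j - A i k *: d k).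
have -> : d i - A i j *: d j - A i k *: d k != 0.
  apply/eqP => /rowP/(_ i); rewrite !mxE !eqxx (negPf ij) (negPf ik) !mulr0 !subr0.
  by move/eqP; rewrite oner_eq0.
rewrite !(mxformBl, mxformBr, mxformZl, mxformZr) !mxform_delta !mxE !eqxx.
rewrite !(eq_sym j i) !(eq_sym k) !A_diag.
rewrite (negPf ij) (negPf ik) (negPf jk) (A_sym j i) (A_sym k i) (A_sym k j) /=.
move=> /(_ isT); move: ij1 ik1 jk1 neg; move: (A i j) (A i k) (A j k) => a b c.
rewrite !mulr1n !mulr0n => a1 b1 c1 abc; nra.
Qed.

(** An arbitrary edge at y, relative to which the edges at y are signed. *)
Definition ref_edge (y : W) : option 'I_n := [pick w | y \in val (phi w)].

(** A signed incidence matrix of T with A + 2 as its Gram matrix: as the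
    triangles of the clique formed by the edges at y are positive, the signs
    relative to one of these edges suffice. *)
Definition inc (y : W) (i : 'I_n) : R :=
  if y \in val (phi i) then
    (if ref_edge y is Some w then (if i == w then 1 else A i w) else 0) else 0.

Lemma inc_sqr y i : y \in val (phi i) -> inc y i ^+ 2 = 1.
Proof.
move=> yi; rewrite /inc yi /ref_edge; case: pickP => [w yw|/(_ i)]; last by rewrite yi.
by case: eqVneq => [_|iw]; rewrite ?expr1n // (A2_meet iw yi yw).
Qed.

(** Both edges and the reference edge at y form a positive triangle. *)
Lemma inc_mul y i j : i != j -> y \in val (phi i) -> y \in val (phi j) ->
  inc y i * inc y j = A i j.
Proof.
move=> ij yi yj; rewrite /inc yi yj /ref_edge.
case: pickP => [w yw|/(_ i)]; last by rewrite yi.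
case: eqVneq => [<-|iw]; first by rewrite eq_sym (negPf ij) mul1r A_sym.
case: eqVneq => [<-|jw]; first by rewrite mulr1.
rewrite (A_sym i w) (A_sym j w); rewrite eq_sym in iw; rewrite eq_sym in jw.
apply: triangle_positive => //.
- exact: (A2_meet iw yw yi).
- exact: (A2_meet jw yw yj).
- exact: (A2_meet ij yi yj).
Qed.

Lemma inc_out y i : y \notin val (phi i) -> inc y i = 0.
Proof. by rewrite /inc => /negPf->. Qed.

(** Two distinct edges of a simple graph share at most one vertex, so
    at most one term of an off-diagonal sum is nonzero. *)
Lemma sum_inc i j : \sum_y inc y i * inc y j = (A - (-2)%:M) i j.
Proof.
rewrite !mxE; case: (eqVneq i j) => [<-|ij] /=.
  rewrite A_diag mulr1n sub0r opprK.
  rewrite (bigID (fun y => y \in val (phi i))) /= [X in _ + X]big1 => [|y yi].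
    rewrite addr0 (eq_bigr (fun=> 1)) => [|y yi]; last by rewrite -expr2 inc_sqr.
    by rewrite sumr_const (edges_card2 (valP (phi i))).
  by rewrite inc_out // mul0r.
rewrite mulr0n subr0.
case: (pickP [pred y | (y \in val (phi i)) && (y \in val (phi j))]) => [y /andP[yi yj]|no].
  rewrite (bigD1 y) //= inc_mul // big1 ?addr0 // => z zy.
  have [zi|zi] := boolP (z \in val (phi i)); last by rewrite inc_out ?mul0r.
  have [zj|zj] := boolP (z \in val (phi j)); last by rewrite (inc_out zj) mulr0.
  case/eqP: ij; apply: phi_inj; apply: val_inj.
  have aux k : y \in val (phi k) -> z \in val (phi k) -> val (phi k) = [set y; z].
    move=> yk zk; apply/esym/eqP; rewrite eqEcard subUset !sub1set yk zk /=.
    by rewrite (edges_card2 (valP (phi k))) cards2 eq_sym zy.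
  by rewrite (aux i) // (aux j).
rewrite A0_disjoint // => [|y yi yj]; last by have := no y; rewrite /= yi yj.
apply: big1 => y _; have := no y => /=; have [yi /= yj|yi _] := boolP (y \in val (phi i)).
  by rewrite (@inc_out _ j) ?mulr0 // yj.
by rewrite inc_out ?mul0r.
Qed.

Lemma mxform_inc x : mxform (A - (-2)%:M) x x = \sum_y (\sum_i inc y i * x 0 i) ^+ 2.
Proof.
rewrite mxformE; under eq_bigr do under eq_bigr do rewrite -sum_inc mulr_sumr mulr_suml.
under eq_bigr do rewrite exchange_big.
rewrite exchange_big; apply: eq_bigr => y _ /=.
rewrite expr2 mulr_suml; apply: eq_bigr => i _; rewrite mulr_sumr.
by apply: eq_bigr => j _; ring.
Qed.

(** Subtracting 1 at the end-edge v cancels the square at the leaf r, leaving the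
    squares at the other vertices of T. If x is nonzero, its support
    is a nonempty forest, which has a leaf other than r, and the square there
    is positive. *)
Lemma posdef_drop_leaf v r : acyclic_graph T -> valency T r = 1%N ->
  r \in val (phi v) -> posdef (A - delta_mx v v - (-2)%:M).
Proof.
move=> acT r1 rv x x0.
have inc_r i : i != v -> inc r i = 0.
  move=> iv; apply: inc_out; apply: contraNN iv => ri.
  apply/eqP/phi_inj/val_inj.
  exact: (valency1_edge r1 (valP (phi i)) (valP (phi v))).
have -> : mxform (A - delta_mx v v - (-2)%:M) x x =
    \sum_(y | y != r) (\sum_i inc y i * x 0 i) ^+ 2.
  have -> : A - delta_mx v v - (-2)%:M = (A - (-2)%:M) + (-1) *: delta_mx v v.
    by rewrite scaleN1r addrAC.
  rewrite mxformDM mxform_inc (bigD1 r) //= (bigD1 v) //= big1 => [|i iv]; last first.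
    by rewrite inc_r // mul0r.
  rewrite addr0 exprMn inc_sqr // mul1r addrAC -[RHS]add0r; congr (_ + _).
  rewrite mxformE (bigD1 v) //= (bigD1 v) //= !big1 => [|i iv|i iv].
  - by rewrite !mxE !eqxx !addr0 /= mulr1 mulrN1 mulNr -expr2 subrr.
  - by apply: big1 => j _; rewrite !mxE (negPf iv) !mulr0 mul0r.
  - by rewrite !mxE (negPf iv) andbF !mulr0 mul0r.
pose F : {set {set W}} := [set val (phi i) | i in [pred i | x 0 i != 0]].
have [||y yr [E /imsetP[i xi ->] [yi iuniq]]] := @forest_leaf W T F acT _ r.
- by apply/subsetP => E /imsetP[i _ ->]; exact: valP.
- apply: contraNneq x0 => F0; apply/eqP/rowP => i; rewrite mxE.
  apply/eqP; apply: contraT => xi.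
  by have : val (phi i) \in F by [exact: imset_f]; rewrite F0 inE.
rewrite (bigD1 y) //= ltr_pwDl ?sumr_ge0 // => [|z _]; last exact: sqr_ge0.
rewrite (bigD1 i) //= big1 => [|j ji].
  by rewrite addr0 exprMn inc_sqr // mul1r exprn_even_gt0.
have [->|xj] := eqVneq (x 0 j) 0; first by rewrite mulr0.
rewrite inc_out ?mul0r //; apply: contraNN ji => yj; apply/eqP/phi_inj/val_inj.
by apply: iuniq => //; apply/imsetP; exists j.
Qed.

End Incidence.

(** * Signed adjacency matrices *)

Lemma sub_delta_mxE (R : pzRingType) n (A : 'M[R]_n) k i j :
  (A - delta_mx k k) i j = A i j - ((i == k) && (j == k))%:R.
Proof. by rewrite !mxE. Qed.

Lemma sub_scalar_mxE (R : pzRingType) n (A : 'M[R]_n) c i j :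
  (A - c%:M) i j = A i j - c *+ (i == j).
Proof. by rewrite !mxE. Qed.

Section Signed.
Variables (R : realType) (V : finType) (G : esgraph V) (v : V).
Local Notation A := (adjmx R G).
Local Notation v0 := (enum_rank v).

Lemma adjmx_sym : A^T = A.
Proof. by apply/matrixP => i j; rewrite !mxE setUC. Qed.

Lemma adjmx_sqr i j :
  A i j ^+ 2 = (adj (underlying G) (enum_val i) (enum_val j))%:R.
Proof.
rewrite mxE /adj inE; case: (_ \in pos_edges G) => /=; first by rewrite expr1n.
by case: (_ \in neg_edges G); rewrite ?sqrrN ?expr1n ?expr0n.
Qed.

Lemma adj_irr (H : sgraph V) x : adj H x x = false.
Proof. by apply/negP => /edges_card2; rewrite cards2 eqxx. Qed.

Lemma adjmx_diag i : A i i = 0.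
Proof. by apply/eqP; rewrite -sqrf_eq0 adjmx_sqr adj_irr. Qed.

Lemma adjmx_hatE : adjmx_hat R G v = A - delta_mx v0 v0.
Proof.
apply/matrixP => i j; rewrite sub_delta_mxE [LHS]mxE.
case: ifP => [/andP[/eqP-> /eqP->]|_]; last by rewrite subr0.
by rewrite adjmx_diag sub0r.
Qed.

Lemma adjmx_hat_sym : (adjmx_hat R G v)^T = adjmx_hat R G v.
Proof. by rewrite adjmx_hatE linearB /= adjmx_sym trmx_delta. Qed.

Let card_gt0 : (0 < #|V|)%N. Proof. by apply/card_gt0P; exists v. Qed.

Lemma tree_hat_gt : -2 < lambda1 A ->
  line_graph_of_tree_at_end_edge (underlying G) v -> -2 < lambda1 (adjmx_hat R G v).
Proof.
move=> /(lambda1_gtP _ card_gt0 adjmx_sym) pd [W [T [f [[_ acT] [bf fadj] [_ [r rv r1]]]]]].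
apply/(lambda1_gtP _ card_gt0 adjmx_hat_sym); rewrite adjmx_hatE.
apply: (@posdef_drop_leaf _ _ T _ (fun i => f (enum_val i)) A _ adjmx_sym _ pd v0 r acT r1).
- exact: inj_comp (bij_inj bf) enum_val_inj.
- by move=> i j; rewrite adjmx_sqr fadj.
- by rewrite enum_rankK.
Qed.

Let M := adjmx_hat R G v - (-2)%:M.

(** Off the diagonal M agrees with A, so paths of G are paths of nonzero entries
    of M, and [unit_basis_exists] applies. *)
Lemma hat_unit_basis : connected_graph (underlying G) ->
  -2 < lambda1 (adjmx_hat R G v) ->
  exists p r e b, parent_tree setT v0 p r /\ unit_basis M setT p e b.
Proof.
move=> [_ conn] /(lambda1_gtP _ card_gt0 adjmx_hat_sym) pd.
have ME i j : M i j = A i j - ((i == v0) && (j == v0))%:R + 2 * (i == j)%:R.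
  by rewrite /M adjmx_hatE sub_scalar_mxE sub_delta_mxE mulNrn opprK mulr_natr.
have Aint i j : A i j \is a Num.int.
  by rewrite mxE; case: ifP => // _; case: ifP; rewrite ?rpredN ?rpred1 ?rpred0.
apply: unit_basis_exists => //.
- by rewrite /M linearB /= adjmx_hat_sym tr_scalar_mx.
- move=> i j; rewrite ME; apply: rpredD; first by rewrite rpredB ?rpred_nat.
  by rewrite rpredM ?rpred_nat.
- by rewrite ME adjmx_diag !eqxx /=; lra.
- by move=> i iv; rewrite ME adjmx_diag !eqxx (negPf iv) /=; lra.
move=> i j; have /connectP[q] := conn (enum_val i) (enum_val j).
elim: q i => [|y q IH] i /=.
  by move=> _ /enum_val_inj->; exact: connect0.
move=> /andP[iy yq] jq; apply: (connect_trans _ (IH (enum_rank y) _ _)); rewrite ?enum_rankK //.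
have yi : (i == enum_rank y) = false.
  by apply/negP => /eqP iE; rewrite iE enum_rankK adj_irr in iy.
apply: connect1; rewrite /= ME yi mulr0 addr0.
have -> : (i == v0) && (enum_rank y == v0) = false.
  by apply/negP => /andP[/eqP iE /eqP yE]; rewrite iE yE eqxx in yi.
by rewrite subr0 -sqrf_eq0 adjmx_sqr enum_rankK iy oner_eq0.
Qed.

(** The vertex x of G becomes the edge from x to its parent; v becomes the edge
    at the leaf [None]. *)
Lemma hat_gt_tree : connected_graph (underlying G) ->
  -2 < lambda1 (adjmx_hat R G v) ->
  line_graph_of_tree_at_end_edge (underlying G) v.
Proof.
move=> hc hv; have [p [r [e [b [tP bP]]]]] := hat_unit_basis hc hv.
have eT i : parent_edge p i \in edges (parent_graph tP) by exact: imset_f.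
pose f (x : V) : edge_type (parent_graph tP) :=
  exist (fun E => E \in edges (parent_graph tP)) _ (eT (enum_rank x)).
have f_inj : injective f.
  by move=> x y /(congr1 val)/(parent_edge_inj tP)/enum_rank_inj.
exists (option 'I_#|V|), (parent_graph tP), f; split.
- exact: parent_graph_tree.
- split=> [|x y].
    apply: inj_card_bij f_inj _; rewrite card_sig.
    by rewrite (card_imset _ (parent_edge_inj tP)) card_ord.
  rewrite adj_line_graph (inj_eq f_inj); have [->|xy] := eqVneq x y.
    by rewrite adj_irr.
  have rxy : enum_rank x != enum_rank y by rewrite (inj_eq enum_rank_inj).
  rewrite /= -(unit_basis_meet tP bP rxy).
  rewrite /M adjmx_hatE sub_scalar_mxE sub_delta_mxE (negPf rxy) mulr0n subr0.
  have -> : (enum_rank x == v0) && (enum_rank y == v0) = false.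
    by apply/negP => /andP[/eqP iE /eqP yE]; rewrite iE yE eqxx in rxy.
  rewrite subr0 -sqrf_eq0 adjmx_sqr !enum_rankK.
  by case: (adj _ x y); rewrite ?oner_eq0 ?eqxx.
- split; first exact: eT.
  exists None; last exact: valency_root.
  by rewrite /= !inE (parent_root tP).
Qed.

(** If the inequality failed, an eigenvector x of A for its smallest eigenvalue
    would, as its form under the modified matrix is smaller by x_v^2, vanish at v
    and be an eigenvector of the modified matrix too, contradicting
    [min_eigenvector_root]. *)
Lemma hat_gt_strict : connected_graph (underlying G) -> -2 < lambda1 A ->
  -2 < lambda1 (adjmx_hat R G v) -> lambda1 (adjmx_hat R G v) < lambda1 A.
Proof.
move=> hc hA hv; have [p [r [e [b [tP bP]]]]] := hat_unit_basis hc hv.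
rewrite ltNge; apply/negP => le.
have [/eigenvalueP[x xA x0] _] := lambda1_min card_gt0 adjmx_sym.
set a := lambda1 A in hA le xA *.
have MuP y : (a + 2) * (y *m y^T) 0 0 <= mxform M y y.
  have -> : mxform M y y = mxform (adjmx_hat R G v) y y + 2 * (y *m y^T) 0 0.
    by rewrite mxformBscalar mulNr opprK.
  rewrite mulrDl lerD2r; apply: le_trans (rayleigh y adjmx_hat_sym).
  by rewrite ler_wpM2r // sqnorm_ge0.
have xM : x *m M = (a + 2) *: x - x 0 v0 *: delta_mx 0 v0.
  rewrite /M adjmx_hatE !mulmxBr xA mul_mx_scalar -scaleNr opprK addrAC.
  congr (_ - _); first by rewrite [RHS]scalerDl.
  apply/rowP => j; rewrite !mxE (bigD1 v0) //= big1 => [|k kv].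
    by rewrite !mxE eqxx addr0.
  by rewrite !mxE (negPf kv) mulr0.
have xv : x 0 v0 = 0.
  have := MuP x; have -> : mxform M x x = (a + 2) * (x *m x^T) 0 0 - x 0 v0 ^+ 2.
    by rewrite /mxform xM mulmxBl -!scalemxAl -rowE !mxE expr2.
  have := sqr_ge0 (x 0 v0); move=> h1 h2.
  by apply/eqP; rewrite -sqrf_eq0; apply/eqP; lra.
case/eqP: x0; apply: (min_eigenvector_root tP bP _ MuP) => //.
- lra.
- by rewrite xM xv scale0r subr0.
Qed.
End Signed.

Theorem theorem15 (R : realType) (V : finType) (G : esgraph V) (v : V)
    (hconn : connected_graph (underlying G))
    (hG : lambda1 (adjmx R G) > -2) :
  [/\ lambda1 (adjmx R G) > lambda1 (adjmx_hat R G v),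
      lambda1 (adjmx_hat R G v) > -2 <->
        line_graph_of_tree_at_end_edge (underlying G) v
    & ~ line_graph_of_tree_at_end_edge (underlying G) v ->
        lambda1 (adjmx_hat R G v) <= -2].
Proof.
split.
- have [le|gt] := leP (lambda1 (adjmx_hat R G v)) (-2); first exact: le_lt_trans hG.
  exact: hat_gt_strict.
- by split; [exact: hat_gt_tree|exact: tree_hat_gt].
- by move=> notT; rewrite leNgt; apply/negP => /(hat_gt_tree hconn).
Qed.
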